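(* Consider the linear SDE in $\mathbb R^d$ $$\mathrm dX^{\mathrm{true}}(t)=A(t)X^{\mathrm{true}}(t)\mathrm dt+\sum_{i=1}^mB_i(t)X^{\mathrm{true}}(t)\mathrm dW^i_t,\qquad t\in[0,+\infty),$$ with deterministic time-dependent matrices $A(t),B_i(t)\in\mathbb R^{d\times d}$, $i=1,\dots,m$. Let $0=t_0<t_1<\dots$ be a time grid with steps $\Delta t_n=t_{n+1}-t_n$, and suppose that for all $n$ $$\Big|1+\lambda_{\max}(A(t_n)+A(t_n)^\top)\Delta t_n+\sigma_{\max}(A(t_n))^2(\Delta t_n)^2+\sum_{i=1}^m|B_i(t_n)|^2\Delta t_n\Big|<1 .$$ Then the DLR Projector Splitting scheme for Euler--Maruyama applied to this linear SDE is asymptotically mean-square stable.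
   Context: Notation. $W=(W^1,\dots,W^m)$ is an $m$-dimensional $(\mathcal F_t)$-Brownian motion on a filtered complete probability space with the usual conditions; $|v|$ is the Euclidean norm, $|B|$ the spectral norm, $\sigma_{\max}$ the largest singular value, $\lambda_{\max}$ the largest eigenvalue of a symmetric matrix; $1\le k\le d$. As a standing assumption $x\mapsto A(t)x$, $x\mapsto B_i(t)x$ are Lipschitz uniformly in $t$. For $Y\in L^2(\Omega;\mathbb R^k)$, $C_Y:=\mathbb E[YY^\top]$; for $U\in\mathbb R^{k\times d}$ with orthonormal rows, $P_U:=U^\top U$; $\Delta W^i_n=W^i(t_{n+1})-W^i(t_n)$. DLR Projector Splitting scheme for Euler--Maruyama, applied to this SDE. Given $U_0$ with $U_0U_0^\top=I_{k\times k}$ and $\mathcal F_0$-measurable $Y_0\in L^2(\Omega;\mathbb R^k)$, put $X_n=U_n^\top Y_n$, $D_n=A(t_n)X_n\Delta t_n+\sum_{i=1}^mB_i(t_n)X_n\Delta W^i_n$, and for $n\ge0$ set $\tilde Y_{n+1}=Y_n+U_nD_n$, let $\tilde U_{n+1}$ solve $$C_{\tilde Y_{n+1}}\tilde U_{n+1}=C_{\tilde Y_{n+1}}U_n+\mathbb E[\tilde Y_{n+1}D_n^\top](I_{d\times d}-P_{U_n})$$ (minimal norm solution if $C_{\tilde Y_{n+1}}$ is singular), compute a reduced QR decomposition $\tilde U_{n+1}^\top=U_{n+1}^\top R_{n+1}$ with $U_{n+1}U_{n+1}^\top=I_{k\times k}$, and set $Y_{n+1}=R_{n+1}\tilde Y_{n+1}$.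 Stability. Asymptotic mean-square stability of the scheme is the discrete analogue of asymptotic $2$-stability of the zero solution: $\sup_{n\ge 0}\mathbb E[|X_n|^2]\to0$ as $\mathbb E[|X_0|^2]\to0$, and $\lim_{n\to\infty}\mathbb E[|X_n|^2]=0$ for all (sufficiently small) initial data.
   Formalization: The claim that E|X_n|^2 tends to 0 is false if the factors |...| < 1 tend to 1 too fast (k=d=1, B=0, t_n=n, A(t)=-1/(2(1+t)^2)); it is proved assuming also that the product of the factors over j<n tends to 0. The sup part of stability is proved as stated. *)

(* Defs.v *)
(* Linear SDEs with deterministic time-dependent coefficients and the dynamical
   low-rank (DLR) projector-splitting scheme for Euler--Maruyama.

   Random vectors are functions T -> 'cV[R]_n; measurability and square
   integrability are stated componentwise.  The time axis is [0, +oo[: families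
   indexed by t : R are only constrained at t >= 0. *)
From HB Require Import structures.
From mathcomp Require Export all_boot all_order all_algebra.
From mathcomp Require Export all_classical all_reals all_analysis.
Set Implicit Arguments.
Unset Strict Implicit.
Unset Printing Implicit Defensive.
Import Order.TTheory GRing.Theory Num.Theory.
Export numFieldNormedType.Exports.
Local Open Scope classical_set_scope.
Local Open Scope ring_scope.

Section matrices.
Context {R : realType}.

(* The library norm on matrices is the maximum norm, hence these definitions. *)
Definition euclid_norm n (v : 'cV[R]_n) : R :=
  Num.sqrt (\sum_(i < n) v i ord0 ^+ 2).

Definition frob_norm p q (M : 'M[R]_(p, q)) : R :=
  Num.sqrt (\sum_(i < p) \sum_(j < q) M i j ^+ 2).

(* Matrix norm induced by the Euclidean norm. *)
Definition spectral_norm n (M : 'M[R]_n) : R :=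
  sup [set euclid_norm (M *m x) | x in [set x | euclid_norm x <= 1]].

(* For n > 0 and S symmetric, the set of eigenvalues is finite and nonempty, so
   this supremum is a maximum. *)
Definition lambda_max n (S : 'M[R]_n) : R := sup [set a | eigenvalue S a].

Definition singular_value n (M : 'M[R]_n) (s : R) : Prop :=
  0 <= s /\ eigenvalue (M^T *m M) (s ^+ 2).

Definition sigma_max n (M : 'M[R]_n) : R := sup [set s | singular_value M s].

Definition orthonormal_rows k d (U : 'M[R]_(k, d)) : Prop :=
  U *m U^T = 1%:M.

Definition rowproj k d (U : 'M[R]_(k, d)) : 'M[R]_d := U^T *m U.

(* V has minimal Frobenius norm among the solutions of C V = G; if C is
   invertible, V is simply the unique solution. *)
Definition min_norm_solution k d (C : 'M[R]_k) (G V : 'M[R]_(k, d)) : Prop :=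
  C *m V = G /\
  (forall V' : 'M[R]_(k, d), C *m V' = G -> frob_norm V <= frob_norm V').

(* Reduced QR decomposition V^T = U^T Q of the d x k matrix V^T, with U^T having
   orthonormal columns and Q upper triangular. *)
Definition reduced_QR k d (V U : 'M[R]_(k, d)) (Q : 'M[R]_k) : Prop :=
  [/\ V^T = U^T *m Q, orthonormal_rows U & is_trig_mx Q^T].

(* x |-> M(t) x is Lipschitz on R^n, uniformly in t >= 0. *)
Definition uniformly_lipschitz n (M : R -> 'M[R]_n) : Prop :=
  exists L : R, forall (t : R) (x y : 'cV[R]_n), 0 <= t ->
    euclid_norm (M t *m x - M t *m y) <= L * euclid_norm (x - y).

End matrices.

Section probability_setting.
Context {d0 : measure_display} {T : measurableType d0} {R : realType}.
Variable P : probability T R.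

(* A filtration on a complete space, satisfying the usual conditions. *)
Definition usual_filtration (F : R -> set (set T)) : Prop :=
  [/\ measure_is_complete P,
      forall t, 0 <= t -> sigma_algebra [set: T] (F t) /\ F t `<=` measurable,
      forall s t, 0 <= s -> s <= t -> F s `<=` F t,
      forall N, P.-negligible N -> F 0 N
    & forall t, 0 <= t -> \bigcap_(s in [set s | t < s]) F s `<=` F t].

(* m-dimensional F-Brownian motion.  The third and fourth clauses say that the
   components of W t - W s are N(0, t - s) (normal_prob takes the standard
   deviation) and, together with F s, mutually independent. *)
Definition brownian_motion (F : R -> set (set T)) m (W : 'I_m -> R -> T -> R) :
    Prop :=
  let dW i s t (w : T) := W i t w - W i s w in
  [/\ forall i, {ae P, forall w, W i 0 w = 0},
      forall i t (A : set R), 0 <= t -> measurable A -> F t (W i t @^-1` A),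
      forall i s t (A : set R), 0 <= s -> s < t -> measurable A ->
        P (dW i s t @^-1` A) = normal_prob 0 (Num.sqrt (t - s)) A,
      forall s t (G : set T) (A : 'I_m -> set R), 0 <= s -> s < t ->
        F s G -> (forall i, measurable (A i)) ->
        P (G `&` \bigcap_i (dW i s t @^-1` A i)) =
        (P G * \prod_(i < m) P (dW i s t @^-1` A i))%E
    & forall i, {ae P, forall w,
        {within `[0, +oo[%classic, continuous (fun t => W i t w)}}].

(* Y is measurable with respect to the sigma-algebra G and Y \in L^2. *)
Definition L2_vector (G : set (set T)) n (Y : T -> 'cV[R]_n) : Prop :=
  forall i, (forall A : set R, measurable A -> G [set w | A (Y w i ord0)]) /\
    P.-integrable [set: T] (fun w => (Y w i ord0 ^+ 2)%:E).

(* E[Y Z^T], entrywise; mean_outer Y Y is C_Y. *)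
Definition mean_outer p q (Y : T -> 'cV[R]_p) (Z : T -> 'cV[R]_q) :
    'M[R]_(p, q) :=
  \matrix_(i, j) fine 'E_P[fun w => Y w i ord0 * Z w j ord0].

Definition mean_square n (X : T -> 'cV[R]_n) : \bar R :=
  'E_P[fun w => euclid_norm (X w) ^+ 2].

(* Stability of a class S of discrete-time processes: S contains one or more
   trajectories for each initial datum. *)
Section stability.
Context {n : nat}.
Variable S : set (nat -> T -> 'cV[R]_n).

Definition ms_stable : Prop :=
  forall e : R, 0 < e -> exists2 delta : R, 0 < delta &
    forall X, S X -> (mean_square (X 0%N) < delta%:E)%E ->
      (ereal_sup (range (fun j => mean_square (X j))) < e%:E)%E.

Definition ms_attractive : Prop :=
  forall X, S X -> mean_square (X j) @[j --> \oo] --> 0%E.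

Definition asymptotically_ms_stable : Prop := ms_stable /\ ms_attractive.

End stability.

Section scheme.
Context {m d : nat}.
Variables (F : R -> set (set T)) (W : 'I_m -> R -> T -> R).
Variables (A : R -> 'M[R]_d) (B : 'I_m -> R -> 'M[R]_d) (tau : nat -> R).

Definition time_grid : Prop := tau 0 = 0 /\ (forall n, tau n < tau n.+1).

Definition time_step n : R := tau n.+1 - tau n.

(* Euler--Maruyama increment D_n of dX = A X dt + sum_i B_i X dW^i from X_n = X. *)
Definition EM_increment n (X : T -> 'cV[R]_d) (w : T) : 'cV[R]_d :=
  time_step n *: (A (tau n) *m X w) +
  \sum_(i < m) (W i (tau n.+1) w - W i (tau n) w) *: (B i (tau n) *m X w).

Definition DLR_step n k (U : 'M[R]_(k, d)) (Y : T -> 'cV[R]_k)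
    (U' : 'M[R]_(k, d)) (Y' : T -> 'cV[R]_k) : Prop :=
  let D := EM_increment n (fun w => U^T *m Y w) in
  let Yt w := Y w + U *m D w in
  let C := mean_outer Yt Yt in
  exists (Ut : 'M[R]_(k, d)) (Q : 'M[R]_k),
    [/\ min_norm_solution C (C *m U + mean_outer Yt D *m (1%:M - rowproj U)) Ut,
        reduced_QR Ut U' Q
      & forall w, Y' w = Q *m Yt w].

Definition DLR_scheme k (U : nat -> 'M[R]_(k, d)) (Y : nat -> T -> 'cV[R]_k) :
    Prop :=
  [/\ orthonormal_rows (U 0%N),
      L2_vector (F 0) (Y 0%N)
    & forall n, DLR_step n (U n) (Y n) (U n.+1) (Y n.+1)].

(* The processes X_n = U_n^T Y_n of rank at most k produced by the scheme, for all
   initial data and all admissible QR factors. *)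
Definition DLR_solutions k : set (nat -> T -> 'cV[R]_d) :=
  [set X | exists (U : nat -> 'M[R]_(k, d)) (Y : nat -> T -> 'cV[R]_k),
     DLR_scheme U Y /\ X = (fun n w => (U n)^T *m Y n w)].

(* "EM_factor n < 1 for all n" alone does not give E|X_n|^2 -> 0: for k = d = 1,
   B = 0, tau n = n and A(t) = -1 / (2 (1 + t)^2) the scheme is
   X_(n+1) = (1 - 1 / (2 (1 + n)^2)) X_n, and E|X_n|^2 has a positive limit unless
   X_0 = 0.  What is missing there is that the products of the factors tend to 0. *)
Definition EM_factor n : R :=
  `| 1 + lambda_max (A (tau n) + (A (tau n))^T) * time_step n
       + sigma_max (A (tau n)) ^+ 2 * time_step n ^+ 2
       + \sum_(i < m) spectral_norm (B i (tau n)) ^+ 2 * time_step n |.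

End scheme.
End probability_setting.

(* Main.v *)
(* Put Z = X_n + D_n, the full-rank Euler--Maruyama step.  Since U_n X_n = Y_n and
   I - P_(U_n) annihilates X_n, the equation for tilde U is the normal equation
   C (tilde U) = E[(U_n Z) Z^T] with C = E[(U_n Z) (U_n Z)^T].  Hence
   X_(n+1) = (tilde U)^T (U_n Z) is the L^2 projection of Z onto a finite-dimensional
   space, so E|X_(n+1)|^2 <= E|Z|^2, whichever solution and QR factors are chosen.
   The increments of W are centered and independent of each other and of F_(t_n), so
   E|Z|^2 = E|(I + h A) X_n|^2 + h sum_i E|B_i X_n|^2 <= EM_factor n * E|X_n|^2.
   Iterating bounds E|X_n|^2 by the product of the factors times E|X_0|^2. *)
Require Import Defs.
From mathcomp Require Import all_boot all_order all_algebra.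
From mathcomp Require Import all_classical all_reals all_analysis.
From mathcomp Require Import measurable_realfun.
From mathcomp Require Import ring lra.
Set Implicit Arguments.
Unset Strict Implicit.
Unset Printing Implicit Defensive.
Import Order.TTheory GRing.Theory Num.Theory.
Local Open Scope classical_set_scope.
Local Open Scope ring_scope.

(** * Extremal eigenvalues and the spectral norm *)

(** The argument runs on the deterministic matrices $S = E[X_n X_n^T]$, whose traces are the mean
    squares. An Euler--Maruyama step maps $S$ to $M S M^T + h \sum_i B_i S B_i^T$ with $M = I + hA$,
    and the projection becomes a trace inequality. The Brownian motion enters through the mean,
    variance and independence of its increments. [lambda_max] and [sigma_max] are suprema of sets of
    reals, so they bound quadratic forms only once these sets are known to be nonempty and bounded.
    A top eigenvalue is found without compactness or characteristic polynomials, from the fact that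
    an invertible positive semidefinite matrix is coercive. *)

Section euclidean.
Context {R : realType}.

Definition dotv {n} (x y : 'cV[R]_n) : R := \sum_i x i ord0 * y i ord0.

Lemma dotvC n (x y : 'cV[R]_n) : dotv x y = dotv y x.
Proof. by apply: eq_bigr => i _; rewrite mulrC. Qed.

Lemma dotvDl n (x y z : 'cV[R]_n) : dotv (x + y) z = dotv x z + dotv y z.
Proof. by rewrite -big_split; apply: eq_bigr => i _; rewrite mxE mulrDl. Qed.

Lemma dotvZl n a (x z : 'cV[R]_n) : dotv (a *: x) z = a * dotv x z.
Proof. by rewrite mulr_sumr; apply: eq_bigr => i _; rewrite mxE mulrA. Qed.

Lemma dotvDr n (x y z : 'cV[R]_n) : dotv z (x + y) = dotv z x + dotv z y.
Proof. by rewrite dotvC dotvDl !(dotvC z). Qed.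

Lemma dotvZr n a (x z : 'cV[R]_n) : dotv z (a *: x) = a * dotv z x.
Proof. by rewrite dotvC dotvZl (dotvC z). Qed.

Lemma dotvNl n (x z : 'cV[R]_n) : dotv (- x) z = - dotv x z.
Proof. by rewrite -scaleN1r dotvZl mulN1r. Qed.

Lemma dotvNr n (x z : 'cV[R]_n) : dotv z (- x) = - dotv z x.
Proof. by rewrite -scaleN1r dotvZr mulN1r. Qed.

Lemma dotv_mulmxr m n (M : 'M[R]_(m, n)) (x : 'cV[R]_m) (y : 'cV[R]_n) :
  dotv x (M *m y) = dotv (M^T *m x) y.
Proof.
have dotvE k (u v : 'cV[R]_k) : dotv u v = (u^T *m v) ord0 ord0.
  by rewrite mxE; apply: eq_bigr => i _; rewrite mxE.
by rewrite !dotvE mulmxA trmx_mul trmxK.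
Qed.

Lemma dotvv_ge0 n (x : 'cV[R]_n) : 0 <= dotv x x.
Proof. by apply: sumr_ge0 => i _; rewrite -expr2 sqr_ge0. Qed.

Lemma dotvv_eq0 n (x : 'cV[R]_n) : (dotv x x == 0) = (x == 0).
Proof.
apply/eqP/eqP => [xx0|->]; last by rewrite /dotv big1// => i _; rewrite mxE mul0r.
apply/colP => i; rewrite mxE.
have /(_ _ i isT)/eqP := psumr_eq0P _ xx0.
by rewrite mulf_eq0 orbb => H; apply/eqP/H => j _; rewrite -expr2 sqr_ge0.
Qed.

Lemma dotvv_gt0 n (x : 'cV[R]_n) : x != 0 -> 0 < dotv x x.
Proof. by move=> x0; rewrite lt_def dotvv_eq0 x0 dotvv_ge0. Qed.

Lemma euclid_norm_sqr n (x : 'cV[R]_n) : euclid_norm x ^+ 2 = dotv x x.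
Proof. by rewrite sqr_sqrtr ?sumr_ge0// => i _; rewrite sqr_ge0. Qed.

Lemma euclid_norm_ge0 n (x : 'cV[R]_n) : 0 <= euclid_norm x.
Proof. exact: sqrtr_ge0. Qed.

Lemma euclid_norm_le n m (x : 'cV[R]_n) (y : 'cV[R]_m) a : 0 <= a ->
  (euclid_norm x <= a * euclid_norm y) = (dotv x x <= a ^+ 2 * dotv y y).
Proof.
move=> a0; rewrite -!euclid_norm_sqr -exprMn ler_sqr// nnegrE ?mulr_ge0//;
  exact: euclid_norm_ge0.
Qed.

(** A crude bound suffices: it only serves to make suprema finite. The summand 1 in the witness
    keeps [K] positive, so that it can be inverted later. *)
Lemma quadratic_form_bounded n (S : 'M[R]_n) :
  exists2 K, 0 < K & forall x, dotv x (S *m x) <= K * dotv x x.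
Proof.
exists (1 + \sum_i \sum_j `|S i j|).
  by rewrite ltr_wpDr// sumr_ge0// => i _; rewrite sumr_ge0.
move=> x; rewrite mulrDl mul1r ler_wpDl ?dotvv_ge0//.
rewrite mulr_suml; apply: ler_sum => i _.
rewrite mxE mulr_sumr mulr_suml; apply: ler_sum => j _.
rewrite (le_trans (ler_norm _))// mulrCA normrM ler_wpM2l//.
have le_xx l : x l ord0 ^+ 2 <= dotv x x.
  by rewrite /dotv (bigD1 l)//= expr2 lerDl sumr_ge0// => p _; rewrite -expr2 sqr_ge0.
(* The squares of $x_i \pm x_j$ give $|x_i x_j| \le (x_i^2 + x_j^2)/2 \le |x|^2$. *)
have := le_xx i; have := le_xx j.
have := sqr_ge0 (x i ord0 - x j ord0); have := sqr_ge0 (x i ord0 + x j ord0).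
by rewrite ler_norml; move=> *; apply/andP; split; nra.
Qed.

Lemma mulmx_bounded m n (M : 'M[R]_(m, n)) :
  exists2 K, 0 < K & forall x, dotv (M *m x) (M *m x) <= K * dotv x x.
Proof.
have [K K0 HK] := quadratic_form_bounded (M^T *m M).
by exists K => // x; rewrite dotv_mulmxr mulmxA dotvC.
Qed.

(** Semidefiniteness alone gives $|Gx|^2 \le K \langle x, Gx\rangle$, and invertibility gives $|x|^2
    \le L |Gx|^2$; chaining the two yields $c = 1/(KL)$. *)
Lemma unitmx_psd_coercive n (G : 'M[R]_n) : G^T = G -> G \in unitmx ->
  (forall x, 0 <= dotv x (G *m x)) ->
  exists2 c, 0 < c & forall x, c * dotv x x <= dotv x (G *m x).
Proof.
move=> symG uG psd.
have [K K0 HK] := quadratic_form_bounded G.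
have [L L0 HL] := mulmx_bounded (invmx G).
exists (K * L)^-1 => [|x]; first by rewrite invr_gt0 mulr_gt0.
set y := G *m x.
have xy : dotv x x <= L * dotv y y by have := HL y; rewrite /y mulKmx.
(* nonnegativity of the form at x - K^-1 G x *)
have := psd (x - K^-1 *: y).
rewrite mulmxBr -/y -scalemxAr !(dotvDl, dotvDr, dotvNl, dotvNr, dotvZl, dotvZr).
have -> : dotv x (G *m y) = dotv y y by rewrite dotv_mulmxr symG.
move=> H.
have Ky := HK y.
have {}H : K^-1 * dotv y y <= dotv x y.
  have : K^-1 * (K^-1 * dotv y (G *m y)) <= K^-1 * dotv y y.
    by rewrite ler_pM2l ?invr_gt0// ler_pdivrMl.
  by move=> ?; lra.
apply: le_trans H; rewrite invfM -mulrA ler_pM2l ?invr_gt0//.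
by rewrite ler_pdivrMl.
Qed.

(** [eigenvalue] speaks of row vectors acting from the left; symmetry turns them into columns. *)
Lemma eigenvalue_dotv n (S : 'M[R]_n) a : S^T = S -> eigenvalue S a ->
  exists2 v : 'cV[R]_n, v != 0 & S *m v = a *: v.
Proof.
move=> symS /eigenvalueP[v vS v0]; exists v^T; first by rewrite trmx_eq0.
by rewrite -{1}symS -trmx_mul vS linearZ.
Qed.

(** The witness is the supremum of the Rayleigh quotient. Were it not an eigenvalue, $(\sup E) I -
    S$ would be invertible and semidefinite, hence coercive, and the quotient would stay a fixed
    distance below its own supremum. *)
Lemma rayleigh_eigenvalue n (S : 'M[R]_n) : (0 < n)%N -> S^T = S ->
  exists2 l, eigenvalue S l & forall x, dotv x (S *m x) <= l * dotv x x.
Proof.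
case: n S => // n S _ symS.
pose E := [set dotv x (S *m x) | x in [set x : 'cV[R]_n.+1 | dotv x x = 1]].
have hsE : has_sup E.
  split.
    exists (dotv (delta_mx ord0 ord0) (S *m delta_mx ord0 ord0)).
    exists (delta_mx ord0 ord0) => //=.
    rewrite /dotv (bigD1 ord0)//= big1 ?addr0 ?mxE ?mulr1//.
    by move=> i /negPf i0; rewrite mxE i0 mul0r.
  have [K K0 HK] := quadratic_form_bounded S.
  by exists K => _ [x /= x1 <-]; rewrite (le_trans (HK x))// x1 mulr1.
have Rle l : (forall x, dotv x x = 1 -> dotv x (S *m x) <= l) ->
    forall x, dotv x (S *m x) <= l * dotv x x.
  move=> H x; have [->|x0] := eqVneq x 0.
    by rewrite mulmx0 /dotv big1 ?mulr0// => i _; rewrite mxE mul0r.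
  have xx0 := dotvv_gt0 x0.
  have s0 : Num.sqrt (dotv x x) != 0 by rewrite gt_eqF// sqrtr_gt0.
  have s2 : (Num.sqrt (dotv x x))^-1 ^+ 2 = (dotv x x)^-1.
    by rewrite exprVn sqr_sqrtr// ltW.
  have := H ((Num.sqrt (dotv x x))^-1 *: x).
  rewrite -scalemxAr !(dotvZl, dotvZr) !mulrA -expr2 s2 mulVf ?gt_eqF//.
  by move/(_ erefl); rewrite ler_pdivrMl// mulrC.
have supE x : dotv x (S *m x) <= sup E * dotv x x.
  by apply: Rle => {}x x1; apply: sup_upper_bound => //; exists x.
exists (sup E) => //; apply: contraT => nev.
have uG : (sup E)%:M - S \in unitmx.
  move: nev; rewrite /eigenvalue /eigenspace negbK kermx_eq0 row_free_unit.
  by rewrite -opprB -scaleN1r unitmxZ ?unitrN1.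
have symG : ((sup E)%:M - S)^T = (sup E)%:M - S.
  by rewrite linearB /= tr_scalar_mx symS.
have GE x : dotv x (((sup E)%:M - S) *m x) = sup E * dotv x x - dotv x (S *m x).
  by rewrite mulmxBl mul_scalar_mx dotvDr dotvNr dotvZr.
have [x|c c0 Hc] := unitmx_psd_coercive symG uG.
  by rewrite GE subr_ge0.
(* Some unit vector brings the form within less than [c] of [sup E], whereas coercivity leaves a gap
   of at least [c]. *)
have [x Ex] := sup_adherent c0 hsE.
case: Ex => y /= y1 <-; rewrite ltNge => /negP[].
by have := Hc y; rewrite GE y1 !mulr1; lra.
Qed.

Lemma lambda_max_ge n (S : 'M[R]_n) : (0 < n)%N -> S^T = S ->
  forall x, dotv x (S *m x) <= lambda_max S * dotv x x.
Proof.
move=> n0 symS; have [l evl Hl x] := rayleigh_eigenvalue n0 symS.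
rewrite (le_trans (Hl x))// ler_wpM2r ?dotvv_ge0//.
apply: sup_upper_bound => //; split; first by exists l.
(* Testing the Rayleigh bound at an eigenvector shows that [l] dominates every eigenvalue, so the
   supremum is a genuine one. *)
exists l => a /(eigenvalue_dotv symS)[v v0 Sv].
by have := Hl v; rewrite Sv dotvZr ler_pM2r// dotvv_gt0.
Qed.

Lemma sigma_max_ge n (M : 'M[R]_n) : (0 < n)%N ->
  forall x, dotv (M *m x) (M *m x) <= sigma_max M ^+ 2 * dotv x x.
Proof.
move=> n0; have symS : (M^T *m M)^T = M^T *m M by rewrite trmx_mul trmxK.
have [l evl Hl x] := rayleigh_eigenvalue n0 symS.
have SE y : dotv y (M^T *m M *m y) = dotv (M *m y) (M *m y).
  by rewrite -mulmxA dotv_mulmxr trmxK.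
have ev_le a : eigenvalue (M^T *m M) a -> 0 <= a <= l.
  move=> /(eigenvalue_dotv symS)[v v0 Sv].
  have v1 := dotvv_gt0 v0.
  have := Hl v; rewrite Sv dotvZr ler_pM2r// => ->; rewrite andbT.
  by have := dotvv_ge0 (M *m v); rewrite -SE Sv dotvZr pmulr_lge0.
have /andP[l0 _] := ev_le _ evl.
have sl : Num.sqrt l <= sigma_max M.
  apply: sup_upper_bound; last by split; rewrite ?sqrtr_ge0// sqr_sqrtr.
  split; first by exists (Num.sqrt l); split; rewrite ?sqrtr_ge0// sqr_sqrtr.
  exists (Num.sqrt l) => s [s0 /ev_le/andP[_ s2]].
  by rewrite -(ger0_norm s0) -sqrtr_sqr ler_wsqrtr.
rewrite -SE (le_trans (Hl x))// ler_wpM2r ?dotvv_ge0//.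
rewrite -[leLHS]sqr_sqrtr// ler_sqr ?nnegrE ?sqrtr_ge0//.
by rewrite (le_trans _ sl) ?sqrtr_ge0.
Qed.

Lemma spectral_norm_ge n (M : 'M[R]_n) x :
  dotv (M *m x) (M *m x) <= spectral_norm M ^+ 2 * dotv x x.
Proof.
have [K K0 HK] := mulmx_bounded M.
have hs : has_sup [set euclid_norm (M *m x) | x in [set x | euclid_norm x <= 1]].
  split.
    exists (euclid_norm (M *m 0)), 0 => //=.
    by rewrite /euclid_norm big1 ?sqrtr0// => i _; rewrite mxE expr0n.
  exists (Num.sqrt K) => _ [y /= y1 <-].
  have : euclid_norm (M *m y) <= Num.sqrt K * euclid_norm y.
    rewrite euclid_norm_le ?sqrtr_ge0// (sqr_sqrtr (ltW K0)); exact: HK.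
  by move/le_trans; apply; rewrite ler_piMr// sqrtr_ge0.
have s0 : 0 <= spectral_norm M.
  apply: le_trans (euclid_norm_ge0 (M *m 0)) _; apply: sup_upper_bound => //.
  by exists 0 => //=; rewrite /euclid_norm big1 ?sqrtr0// => i _; rewrite mxE expr0n.
have [->|x0] := eqVneq x 0.
  by rewrite mulmx0 /dotv !big1 ?mulr0// => i _; rewrite mxE mul0r.
have nx : 0 < euclid_norm x.
  by rewrite lt_def euclid_norm_ge0 andbT -sqrf_eq0 euclid_norm_sqr dotvv_eq0.
have : euclid_norm (M *m ((euclid_norm x)^-1 *: x)) <= spectral_norm M.
  apply: sup_upper_bound => //; exists ((euclid_norm x)^-1 *: x) => //=.
  rewrite -[leRHS](mulVf (lt0r_neq0 nx)) euclid_norm_le ?invr_ge0 ?(ltW nx)//.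
  by rewrite dotvZl dotvZr mulrA expr2.
rewrite -ler_sqr ?nnegrE ?euclid_norm_ge0// euclid_norm_sqr -scalemxAr.
rewrite dotvZl dotvZr mulrA -expr2 exprVn ler_pdivrMl ?exprn_gt0//.
by rewrite euclid_norm_sqr mulrC.
Qed.

End euclidean.

(** * Moments of the centered Gaussian law *)

Section normal_moments.
Context {R : realType}.
Local Notation mu := (@lebesgue_measure R).

(** Change of variables produces the Radon--Nikodym derivative; it equals the explicit density
    almost everywhere because both have the same integral over every measurable set. *)
Lemma ge0_integral_normal_prob (s : R) (f : R -> \bar R) :
  measurable_fun [set: R] f -> (forall x, 0 <= f x)%E ->
  (\int[normal_prob 0 s]_x f x = \int[mu]_x (f x * (normal_pdf 0 s x)%:E))%E.
Proof.
move=> mf f0.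
have dom := @normal_prob_dominates R 0 s.
rewrite -(Radon_Nikodym_SigmaFinite.change_of_variables dom)//.
have intRN := Radon_Nikodym_SigmaFinite.f_integrable dom.
have mpdf : measurable_fun [set: R] (fun x => (normal_pdf 0 s x)%:E).
  by apply/measurable_EFinP; exact: measurable_normal_pdf.
apply: ae_eq_integral => //.
- by apply: emeasurable_funM => //; case/integrableP : intRN.
- exact: emeasurable_funM.
- apply: ae_eqe_mul2l; apply: integral_ae_eq => // E _ mE.
  by rewrite -Radon_Nikodym_SigmaFinite.f_integral.
Qed.

Section moments.
Variable s : R.
Hypothesis s0 : 0 < s.
Let p : R -> R := normal_pdf 0 s.
Let c : R := (s ^+ 2 *+ 2)^-1.

Let c0 : 0 < c.
Proof. by rewrite invr_gt0 pmulrn_lgt0// exprn_gt0. Qed.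

Let pE x : p x = normal_peak s * expR (- c * x ^+ 2).
Proof. by rewrite /p normal_pdfE ?gt_eqF// /normal_fun subr0 !mulNr [c * _]mulrC. Qed.

Let p_even x : p (- x) = p x.
Proof. by rewrite !pE sqrrN. Qed.

Let p_ge0 x : 0 <= p x.
Proof. exact: normal_pdf_ge0. Qed.

Let cp : continuous p.
Proof. by apply: continuous_normal_pdf; rewrite gt_eqF. Qed.

Let mp : measurable_fun setT p.
Proof. exact: measurable_normal_pdf. Qed.

Let cx2p : continuous (fun x : R => x ^+ 2 * p x).
Proof. by move=> x; apply: cvgM; [exact: exprn_continuous|exact: cp]. Qed.

Let is_derive_p (x : R) : is_derive x (1 : R) p (- x / s ^+ 2 * p x).
Proof.
have -> : p = (normal_peak s \*: (expR \o (- c \*: (@GRing.exp R ^~ 2)))).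
  by apply/funext => y; rewrite pE.
apply: is_derive_eq => /=.
rewrite /GRing.scale /= /c; field.
by rewrite gt_eqF.
Qed.

Let integral_p : (\int[mu]_(x in `[0%R, +oo[) (p x)%:E = (2^-1)%:E)%E.
Proof.
have := @integral_normal_pdf R 0 s.
rewrite ge0_symfun_integralT//; last by move=> x /=; rewrite -/p p_even.
rewrite -set_itvcy -/p.
case: (\int[mu]_(x in `[0%R, +oo[) (p x)%:E)%E => [r| |].
- by rewrite -EFinM => -[] H; congr EFin; lra.
- by rewrite gt0_muley ?lte_fin.
- by rewrite gt0_muleNy ?lte_fin.
Qed.

Let cvg_xp : n%:R * p n%:R @[n --> \oo] --> (0 : R).
Proof.
(* The constant $2/c$ comes from $e^{cn^2} \ge 1 + cn^2$ together with $n(n+1) \le 2n^2$. *)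
have cvgK : (normal_peak s * (2 / c)) * harmonic n @[n --> \oo] --> (0 : R).
  by rewrite -[0](mulr0 (normal_peak s * (2 / c))); apply: cvgMl_tmp; exact: cvg_harmonic.
apply: (squeeze_cvgr _ (cvg_cst 0) cvgK).
near=> n; rewrite mulr_ge0//= pE mulrCA -mulrA ler_wpM2l ?normal_peak_ge0//.
rewrite mulNr expRN ler_pdivrMr ?expR_gt0//.
apply: le_trans (ler_wpM2l _ (expR_ge1Dx _)); last first.
  by rewrite mulr_ge0 ?divr_ge0 ?ltW ?harmonic_gt0.
rewrite mulrAC ler_pdivlMr ?ltr0Sn// mulrDr mulr1 mulrA divfK ?gt_eqF//.
have nn : (n%:R : R) <= n%:R ^+ 2.
  by rewrite -natrX ler_nat; case: (n) => // k; rewrite leq_pmulr.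
rewrite -natr1; have : 0 <= 2 / c by rewrite divr_ge0// ltW.
by nra.
Unshelve. all: end_near. Qed.

Let integral_x2p :
  (\int[mu]_(x in `[0%R, +oo[) (x ^+ 2 * p x)%:E = (s ^+ 2 / 2)%:E)%E.
Proof.
have intc (f : R -> R) (n : nat) : continuous f ->
    mu.-integrable `[0, n%:R] (EFin \o f).
  move=> cf; apply: continuous_compact_integrable; first exact: segment_compact.
  exact: continuous_subspaceT.
(* Integration by parts: $p' = -xp/s^2$ gives $F' = x^2 p - s^2 p$, and the boundary term $F(n)$
   vanishes at infinity by [cvg_xp]. *)
pose F x := - s ^+ 2 * (x * p x).
have dF (x : R) : is_derive x (1 : R) F (x ^+ 2 * p x - s ^+ 2 * p x).
  have dp := is_derive_p x.
  apply: is_derive_eq => /=; rewrite /GRing.scale /=; field; by rewrite gt_eqF.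
(* The successor keeps the interval nondegenerate for the fundamental theorem of calculus. *)
have JI n : (\int[mu]_(x in `[0%R, n.+1%:R]) (x ^+ 2 * p x)%:E =
    (s ^+ 2)%:E * \int[mu]_(x in `[0%R, n.+1%:R]) (p x)%:E + (F n.+1%:R)%:E)%E.
  have -> : F n.+1%:R = F n.+1%:R - F 0 by rewrite /F !mul0r mulr0 subr0.
  rewrite -integralZl//; last exact: intc.
  have cF : continuous F.
    by move=> x; apply/differentiable_continuous/derivable1_diffP; apply: ex_derive.
  have ch : continuous (fun x : R => x ^+ 2 * p x - s ^+ 2 * p x).
    move=> x; apply: cvgB; first exact: cx2p.
    by apply: cvgM; [exact: cvg_cst|exact: cp].
  rewrite EFinB -(@continuous_FTC2 _ (fun x : R => x ^+ 2 * p x - s ^+ 2 * p x))//.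
  - rewrite -integralD//; last exact: intc.
      by apply: eq_integral => x _ /=; rewrite -EFinM -EFinD; congr EFin; ring.
    by apply: (intc (fun x : R => s ^+ 2 * p x)) => x; apply: cvgM; [exact: cvg_cst|exact: cp].
  - exact: continuous_subspaceT.
  - split.
    + by move=> x _; apply: ex_derive.
    + by apply: cvg_at_right_filter; exact: cF.
    + by apply: cvg_at_left_filter; exact: cF.
  - by move=> x _; rewrite derive1E derive_val.
have mx2p : measurable_fun setT (fun x : R => x ^+ 2 * p x).
  exact: continuous_measurable_fun.
have cvgJ := ge0_cvgn_integral (fun x => mulr_ge0 (sqr_ge0 x) (p_ge0 x)) mx2p.
have cvgI : (\int[mu]_(x in `[0%R, n.+1%:R]) (p x)%:E)%E @[n --> \oo]
    --> (2^-1)%:E.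
  rewrite -integral_p (cvg_shiftS (fun n => \int[mu]_(x in `[0%R, n%:R]) (p x)%:E)%E).
  exact: ge0_cvgn_integral.
move: (cvgJ mu); rewrite -cvg_shiftS; under eq_fun do rewrite JI.
move=> {}cvgJ; apply: cvg_unique cvgJ _ => //=.
rewrite (_ : (s ^+ 2 / 2)%:E = (s ^+ 2)%:E * (2^-1)%:E + 0)%E; last by rewrite adde0.
have cI : ((s ^+ 2)%:E * \int[mu]_(x in `[0%R, n.+1%:R]) (p x)%:E)%E @[n --> \oo]
    --> ((s ^+ 2)%:E * (2^-1)%:E)%E.
  by apply: cvgeZl.
apply: (cvgeD _ cI) => //.
apply: cvg_EFin; first exact: nearW.
rewrite -[0](mulr0 (- s ^+ 2)).
by apply: cvgMl_tmp; rewrite (cvg_shiftS (fun n => n%:R * p n%:R)); exact: cvg_xp.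
Qed.

Lemma normal_prob_moment2 : (\int[normal_prob 0 s]_x (x ^+ 2)%:E = (s ^+ 2)%:E)%E.
Proof.
rewrite ge0_integral_normal_prob//; last first.
- by move=> x; rewrite lee_fin sqr_ge0.
- by apply/measurable_EFinP; exact: measurable_funX.
under eq_integral do rewrite -EFinM -/p.
rewrite (@ge0_symfun_integralT _ (fun x => x ^+ 2 * p x))//.
- by rewrite -set_itvcy integral_x2p -EFinM; congr EFin; field.
- by move=> x; rewrite mulr_ge0 ?sqr_ge0.
- by move=> x /=; rewrite sqrrN p_even.
Qed.

Lemma integrable_normal_prob_id :
  (normal_prob 0 s).-integrable [set: R] (fun x : R => x%:E).
Proof.
apply/integrableP; split; first exact/measurable_EFinP.
apply: (@le_lt_trans _ _ (\int[normal_prob 0 s]_x (1 + x ^+ 2)%:E)%E).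
  apply: ge0_le_integral => //.
  - by apply/measurableT_comp => //; exact/measurable_EFinP.
  - by apply/measurable_EFinP; apply: measurable_funD => //; exact: measurable_funX.
  - move=> x _; rewrite lee_fin.
    have := sqr_ge0 (`|x| - 1); rewrite sqrrB real_normK ?num_real//.
    by have := normr_ge0 x; nra.
under eq_integral do rewrite EFinD.
rewrite ge0_integralD//.
- rewrite normal_prob_moment2 (_ : integral _ _ (fun=> 1%E) = 1%E) ?ltry//.
  by rewrite integral_cst// mul1e; exact: integral_normal_pdf.
- by move=> x _; rewrite lee_fin sqr_ge0.
- by apply/measurable_EFinP; exact: measurable_funX.
Qed.

Lemma normal_prob_mean : (\int[normal_prob 0 s]_x x%:E = 0)%E.
Proof.
have mid : measurable_fun [set: R] (EFin : R -> \bar R) by exact/measurable_EFinP.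
rewrite integralE [X in (_ - X)%E](_ : _ =
    \int[normal_prob 0 s]_x (EFin : R -> \bar R)^\+ x)%E.
  by rewrite subee//; exact: integrable_pos_fin_num integrable_normal_prob_id.
rewrite !ge0_integral_normal_prob//; last 2 first.
  exact: measurable_funeneg.
  exact: measurable_funepos.
(* The negative part is carried by the left half-line; since the density is even, the substitution
   of $-x$ for $x$ turns its integral into that of the positive part. The bound [- 0] is the shape
   expected by the substitution lemma. *)
transitivity (\int[mu]_(x in `]-oo, (- 0)%R]) (- x * p x)%:E)%E.
  rewrite [RHS]integral_mkcond; apply: eq_integral => x _.
  rewrite patchE funenegE /= mem_setE in_itv /= oppr0 -EFin_max.
  case: (leP x 0) => x0; rewrite /Num.max ltNge.
    by rewrite oppr_ge0 x0 /=.
  by rewrite oppr_ge0 leNgt x0 /= mul0e.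
rewrite ge0_integration_by_substitutionNy.
- rewrite integral_mkcond; apply: eq_integral => x _.
  rewrite patchE funeposE /= mem_setE in_itv /= andbT -EFin_max opprK p_even.
  by case: leP => x0; rewrite ?mul0e// -EFinM.
- apply: continuous_subspaceT => x; apply: cvgM; last exact: cp.
  by apply: cvgN; exact: cvg_id.
- by move=> x; rewrite in_itv/= oppr0 => x0; rewrite mulr_ge0// oppr_ge0 ltW.
Qed.

End moments.
End normal_moments.

(** * Independence *)

Section independence.
Context {d0 : measure_display} {T : measurableType d0} {R : realType}.
Variable P : probability T R.

Definition independent_pair (f g : T -> R) : Prop :=
  forall A B : set R, measurable A -> measurable B ->
    P (f @^-1` A `&` g @^-1` B) = (P (f @^-1` A) * P (g @^-1` B))%E.

Lemma independent_pair_comp (f g : T -> R) (phi : R -> R) : measurable_fun setT phi ->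
  independent_pair f g -> independent_pair f (phi \o g).
Proof.
move=> mphi fg A B mA mB; rewrite comp_preimage; apply: fg => //.
by rewrite -[X in measurable X]setTI; exact: mphi.
Qed.

(** Independence says that the joint law agrees with the product of the marginal laws on rectangles,
    hence everywhere; Fubini then factors the integral of $xy$. Tonelli for $|xy|$ supplies
    integrability beforehand. *)
Lemma independent_expectationM (f g : T -> R) : independent_pair f g ->
  P.-integrable [set: T] (EFin \o f) -> P.-integrable [set: T] (EFin \o g) ->
  P.-integrable [set: T] (fun w => (f w * g w)%:E) /\
  (\int[P]_w (f w * g w)%:E = \int[P]_w (f w)%:E * \int[P]_w (g w)%:E)%E.
Proof.
move=> fg intf intg.
have mf : measurable_fun setT f by move/integrableP : intf => [/measurable_EFinP].
have mg : measurable_fun setT g by move/integrableP : intg => [/measurable_EFinP].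
pose X : {RV P >-> R} := mfun_Sub (mem_set mf).
pose Y : {RV P >-> R} := mfun_Sub (mem_set mg).
have mfg : measurable_fun setT (fun w => (f w, g w)) by exact: measurable_fun_pair.
pose Z := mfun_Sub (mem_set mfg).
have mid : measurable_fun [set: R] (EFin : R -> \bar R) by exact/measurable_EFinP.
have int_law (V : {RV P >-> R}) : P.-integrable setT (EFin \o V) ->
    (distribution P V).-integrable setT (EFin : R -> \bar R).
  move=> /integrableP[_ H]; apply/integrableP; split => //.
  by rewrite ge0_integral_distribution//; exact: measurableT_comp.
have intX := int_law X intf; have intY := int_law Y intg.
have law C : measurable C ->
    (distribution P X \x distribution P Y)%E C = distribution P Z C.
  apply: product_measure_unique => A B mA mB.
  by rewrite -fg.
have mM : measurable_fun setT (fun z : R * R => (z.1 * z.2)%:E).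
  by apply/measurable_EFinP; exact: measurable_funM.
have intM : (distribution P X \x distribution P Y)%E.-integrable setT
    (fun z : R * R => (z.1 * z.2)%:E).
  apply/integrableP; split => //.
  rewrite fubini_tonelli1//; last exact: measurableT_comp.
  have absE (x : R) : (\int[distribution P Y]_y `|(x * y)%:E| =
      `|x|%:E * \int[distribution P Y]_y `|y%:E|)%E.
    under eq_integral do rewrite abse_EFin normrM EFinM.
    by rewrite ge0_integralZl//; exact: measurableT_comp.
  rewrite /fubini_F; under eq_integral do rewrite absE.
  rewrite ge0_integralZr//; last 2 first.
  - exact: measurableT_comp.
  - exact: integral_ge0.
  move/integrableP : intX => [_ X1]; move/integrableP : intY => [_ Y1].
  by rewrite lte_mul_pinfty// ?integral_ge0// ge0_fin_numE ?integral_ge0.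
have intfg : P.-integrable [set: T] (fun w => (f w * g w)%:E).
  apply/integrableP; split; first by apply/measurable_EFinP; exact: measurable_funM.
  move/integrableP : intM => [_]; rewrite (eq_measure_integral (distribution P Z)).
    rewrite ge0_integral_distribution//.
    exact: measurableT_comp.
  by move=> A mA _; exact: law.
split => //.
transitivity (\int[distribution P Z]_z (z.1 * z.2)%:E)%E.
  by rewrite integral_distribution.
transitivity (\int[distribution P X \x distribution P Y]_z (z.1 * z.2)%:E)%E.
  by apply: eq_measure_integral => A mA _; apply/esym/law.
rewrite -integral12_prod_meas1// /fubini_F.
have -> : (\int[P]_w (f w)%:E = \int[distribution P X]_x x%:E)%E.
  by rewrite integral_distribution//; exact/measurable_EFinP.
have -> : (\int[P]_w (g w)%:E = \int[distribution P Y]_x x%:E)%E.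
  by rewrite integral_distribution//; exact/measurable_EFinP.
have finY : (\int[distribution P Y]_x x%:E)%E \is a fin_num.
  exact: integrable_fin_num intY.
rewrite -[X in (_ * X)%E](fineK finY) -integralZr//.
apply: eq_integral => x _; rewrite fineK//=.
under eq_integral do rewrite EFinM.
by rewrite integralZl.
Qed.

(** For fixed [C], the two sides are measures of a set in the plane of values of $(f, g)$. They
    agree on rectangles, a family closed under intersection, hence also on the preimage [D] of [A]
    under multiplication. *)
Lemma independent_mul (f g h : T -> R) :
  measurable_fun setT f -> measurable_fun setT g -> measurable_fun setT h ->
  (forall A B C : set R, measurable A -> measurable B -> measurable C ->
     P (f @^-1` A `&` (g @^-1` B `&` h @^-1` C)) =
     (P (f @^-1` A) * P (g @^-1` B) * P (h @^-1` C))%E) ->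
  independent_pair (fun w => f w * g w) h.
Proof.
move=> mf mg mh fgh A C mA mC.
have mfg : measurable_fun setT (fun w => (f w, g w)) by exact: measurable_fun_pair.
have mhC : measurable (h @^-1` C) by rewrite -[X in measurable X]setTI; exact: mh.
have c0 : 0 <= fine (P (h @^-1` C)) by rewrite fine_ge0.
pose D := [set z : R * R | A (z.1 * z.2)].
have mD : measurable D.
  by rewrite -[D]setTI; apply: measurable_funM.
pose Z := mfun_Sub (mem_set mfg).
(* The law of $(f, g)$ restricted to the event $h \in C$. *)
pose nu : {measure set (R * R) -> \bar R} :=
  measure_function_pushforward__canonical__measure_function_Measure (mrestr P mhC) mfg.
suff H : nu D = mscale (NngNum c0) (distribution P Z) D.
  move: H; rewrite /nu /= /pushforward /mrestr /mscale /= => ->.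
  by rewrite fineK ?fin_num_measure// muleC.
apply: (measure_unique [set A `*` B | A in measurable & B in measurable] (fun=> setT)).
- by rewrite measurable_prod_measurableType.
- move=> _ _ [A1 mA1 [B1 mB1 <-]] [A2 mA2 [B2 mB2 <-]].
  rewrite -setXI; exists (A1 `&` A2); first exact: measurableI.
  by exists (B1 `&` B2) => //; exact: measurableI.
- by move=> _; exists setT => //; exists setT => //; rewrite setXTT.
- by rewrite bigcup_const.
- move=> _ [A1 mA1 [B1 mB1 <-]].
  rewrite /nu /= /pushforward /mrestr /mscale /=.
  (* Taking the third set to be everything yields the independence of [f] and [g]. *)
  have := fgh A1 B1 C mA1 mB1 mC; have := fgh A1 B1 setT mA1 mB1 measurableT.
  rewrite preimage_setT setIT probability_setT mule1 setIA => <- ->.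
  by rewrite fineK ?fin_num_measure// muleC.
- move=> _; rewrite /nu /= /pushforward /mrestr preimage_setT setTI.
  by rewrite -ge0_fin_numE// fin_num_measure.
- exact: mD.
Qed.

End independence.

(** * Brownian increments *)

Definition measurable_wrt {T : Type} {R : realType} (G : set (set T)) (f : T -> R) :
    Prop :=
  forall A : set R, measurable A -> G (f @^-1` A).

Section measurability_wrt.
Context {R : realType} {T : pointedType}.
Variable G : set (set T).
Hypothesis sG : sigma_algebra [set: T] G.
Local Notation mwrt := (@measurable_wrt T R G).

Let TG := g_sigma_algebraType G.

(** Members of a filtration are bare families of sets; viewing [G] as the sigma-algebra it generates
    makes the closure properties of measurable functions available. *)
Lemma measurable_wrtP (f : T -> R) :
  mwrt f <-> measurable_fun [set: TG] (f : TG -> R).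
Proof.
have GE : <<s G >> = G by exact: sigma_algebra_id.
split=> [mf _ A mA|mf A mA]; first by rewrite setTI; apply: sub_gen_smallest; exact: mf.
by have := mf measurableT A mA; rewrite setTI /measurable /= GE.
Qed.

Lemma measurable_wrt_cst c : mwrt (fun=> c).
Proof. by apply/measurable_wrtP. Qed.

Lemma measurable_wrtD f g : mwrt f -> mwrt g ->
  mwrt (fun w => f w + g w).
Proof.
move=> /measurable_wrtP mf /measurable_wrtP mg; apply/measurable_wrtP.
exact: measurable_funD.
Qed.

Lemma measurable_wrtM f g : mwrt f -> mwrt g ->
  mwrt (fun w => f w * g w).
Proof.
move=> /measurable_wrtP mf /measurable_wrtP mg; apply/measurable_wrtP.
exact: measurable_funM.
Qed.

Lemma measurable_wrtZ c f : mwrt f -> mwrt (fun w => c * f w).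
Proof. by apply: measurable_wrtM; exact: measurable_wrt_cst. Qed.

Lemma measurable_wrtB f g : mwrt f -> mwrt g ->
  mwrt (fun w => f w - g w).
Proof.
move=> mf /(@measurable_wrtZ (-1)) mg.
by under eq_fun do rewrite -mulN1r; exact: measurable_wrtD.
Qed.

End measurability_wrt.

Section brownian_increments.
Context {d0 : measure_display} {T : measurableType d0} {R : realType}.
Variables (P : probability T R) (F : R -> set (set T)) (m : nat).
Variable W : 'I_m -> R -> T -> R.
Hypotheses (hF : usual_filtration P F) (hW : brownian_motion P F W).
Variables (s t : R).
Hypotheses (s0 : 0 <= s) (st : s < t).

Let dW i w := W i t w - W i s w.

Let t0 : 0 <= t. Proof. exact: le_trans s0 (ltW st). Qed.

Lemma filtration_sigma_algebra r : 0 <= r -> sigma_algebra [set: T] (F r).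
Proof. by case: hF => _ + _ _ _ r0 => /(_ r r0)[]. Qed.

Lemma filtration_measurable (r : R) (f : T -> R) : 0 <= r ->
  measurable_wrt (F r) f -> measurable_fun setT f.
Proof.
case: hF => _ + _ _ _ r0 => /(_ r r0)[_ sub] mf _ A mA.
by rewrite setTI; apply: sub; exact: mf.
Qed.

Lemma filtration_mono (r u : R) (f : T -> R) : 0 <= r -> r <= u ->
  measurable_wrt (F r) f -> measurable_wrt (F u) f.
Proof. by case: hF => _ _ Fm _ _ r0 ru mf A mA; apply: Fm ru _ _ => //; exact: mf. Qed.

Lemma brownian_increment_adapted i : measurable_wrt (F t) (dW i).
Proof.
case: hW => _ ad _ _ _.
apply: measurable_wrtB; first exact: filtration_sigma_algebra.
  by move=> A mA; exact: ad.
by apply: filtration_mono s0 (ltW st) _ => A mA; exact: ad.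
Qed.

Lemma measurable_brownian_increment i : measurable_fun setT (dW i).
Proof. exact: filtration_measurable t0 (brownian_increment_adapted i). Qed.

Lemma brownian_increment_indep (i j : 'I_m) (G : set T) (A B : set R) : i != j ->
  F s G -> measurable A -> measurable B ->
  P (G `&` (dW i @^-1` A `&` dW j @^-1` B)) =
  (P G * P (dW i @^-1` A) * P (dW j @^-1` B))%E.
Proof.
move=> ij FG mA mB; case: hW => _ _ _ ind _.
(* The remaining coordinates are left unconstrained and contribute factors 1. *)
pose C l := if l == i then A else if l == j then B else setT.
have mC l : measurable (C l) by rewrite /C; do 2 case: ifP => // _.
have := ind s t G C s0 st FG mC.
rewrite (bigD1 i)//= (bigD1 j) /= 1?eq_sym// big1 ?mule1; last first.
  by move=> l /andP[li lj]; rewrite /C (negPf li) (negPf lj) preimage_setT probability_setT.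
rewrite {2 3}/C eqxx eq_sym (negPf ij) eqxx muleA => <-.
congr (P (_ `&` _)); apply/seteqP; split => [w [Aw Bw] l _ /=|w H].
  by rewrite /C; case: eqP => [->//|_]; case: eqP => [->|].
split; first by have := H i I; rewrite /C eqxx.
by have := H j I; rewrite /C eq_sym (negPf ij) eqxx.
Qed.

Lemma brownian_increment_indep1 (i : 'I_m) (f : T -> R) : measurable_wrt (F s) f ->
  independent_pair P f (dW i).
Proof.
move=> mf A B mA mB; case: hW => _ _ _ ind _.
pose C l := if l == i then B else setT.
have mC l : measurable (C l) by rewrite /C; case: ifP.
have := ind s t _ C s0 st (mf _ mA) mC.
rewrite (bigD1 i)//= big1 ?mule1; last first.
  by move=> l li; rewrite /C (negPf li) preimage_setT probability_setT.
rewrite {2}/C eqxx => <-.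
congr (P (_ `&` _)); apply/seteqP; split => [w Bw l _ /=|w H].
  by rewrite /C; case: eqP => [->|].
by have := H i I; rewrite /C eqxx.
Qed.

(* The library's Gaussian law lives on [measurableTypeR R], whose display differs
   from that of the canonical measurable structure on [R]. *)
Let measurable_dWR i : @measurable_fun _ _ T (measurableTypeR R) setT (dW i).
Proof. exact: measurable_brownian_increment. Qed.

Let dWm i : {mfun T >-> measurableTypeR R} :=
  @mfun_Sub _ _ T (measurableTypeR R) (dW i) (mem_set (measurable_dWR i)).

Let s' := Num.sqrt (t - s).

Let s'0 : 0 < s'.
Proof. by rewrite sqrtr_gt0 subr_gt0. Qed.

Let law i A : measurable A -> distribution P (dWm i) A = normal_prob 0 s' A.
Proof. by case: hW => _ _ + _ _ mA => /(_ i s t A s0 st mA). Qed.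

Let integral_law i (f : R -> \bar R) :
  (\int[normal_prob 0 s']_x f x = \int[distribution P (dWm i)]_x f x)%E.
Proof. by apply: eq_measure_integral => A mA _; exact/esym/law. Qed.

Lemma integrable_brownian_increment i : P.-integrable setT (EFin \o dW i).
Proof.
apply/integrableP; split; first exact/measurable_EFinP/measurable_brownian_increment.
have /integrableP[mid] := integrable_normal_prob_id s'0.
rewrite (integral_law i).
by rewrite ge0_integral_distribution//; exact: measurableT_comp.
Qed.

Lemma brownian_increment_mean i : (\int[P]_w (dW i w)%:E = 0)%E.
Proof.
rewrite -(normal_prob_mean s'0) (integral_law i).
by rewrite integral_distribution//; exact: integrable_brownian_increment.
Qed.

Lemma brownian_increment_var i : (\int[P]_w (dW i w ^+ 2)%:E = (t - s)%:E)%E.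
Proof.
have := normal_prob_moment2 s'0; rewrite sqr_sqrtr ?subr_ge0 ?(ltW st)// => <-.
rewrite (integral_law i).
rewrite ge0_integral_distribution// => [|y]; last by rewrite lee_fin sqr_ge0.
by apply/measurable_EFinP; exact: measurable_funX.
Qed.

Lemma integrable_brownian_increment_sqr i :
  P.-integrable setT (EFin \o (fun w => dW i w ^+ 2)).
Proof.
apply/integrableP; split.
  by apply/measurable_EFinP/measurable_funX; exact: measurable_brownian_increment.
under eq_integral do rewrite /= ger0_norm ?sqr_ge0//.
by rewrite brownian_increment_var ltry.
Qed.

Lemma expectation_mul_increment i f : measurable_wrt (F s) f ->
  P.-integrable setT (EFin \o f) ->
  P.-integrable setT (fun w => (f w * dW i w)%:E) /\
  (\int[P]_w (f w * dW i w)%:E = 0)%E.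
Proof.
move=> mf intf.
have [? ->] := independent_expectationM (brownian_increment_indep1 i mf) intf
  (integrable_brownian_increment i).
by rewrite brownian_increment_mean mule0.
Qed.

(** On the diagonal, [f] is independent of the squared increment. Off the diagonal, the product of
    [f] and the first increment is independent of the second, which has mean 0. *)
Lemma expectation_mul_increments i j f : measurable_wrt (F s) f ->
  P.-integrable setT (EFin \o f) ->
  P.-integrable setT (fun w => (f w * dW i w * dW j w)%:E) /\
  (\int[P]_w (f w * dW i w * dW j w)%:E =
    ((i == j)%:R * (t - s))%:E * \int[P]_w (f w)%:E)%E.
Proof.
move=> mf intf; have [<-{j}|ij] := eqVneq i j.
  have ind : independent_pair P f (fun w => dW i w ^+ 2).
    apply: (@independent_pair_comp _ _ _ P f (dW i) (fun x => x ^+ 2)).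
      exact: (measurable_funX 2 (@measurable_id _ R setT)).
    exact: brownian_increment_indep1.
  have [H1 H2] := independent_expectationM ind intf (integrable_brownian_increment_sqr i).
  under eq_fun do rewrite -mulrA -expr2.
  by rewrite mul1r muleC -(brownian_increment_var i).
have [int1 _] := expectation_mul_increment i mf intf.
have ind : independent_pair P (fun w => f w * dW i w) (dW j).
  apply: independent_mul => //; [exact: filtration_measurable mf|
    exact: measurable_brownian_increment|exact: measurable_brownian_increment|].
  by move=> A B C mA mB mC; apply: brownian_increment_indep => //; exact: mf.
have [H1 ->] := independent_expectationM ind int1 (integrable_brownian_increment j).
by split => //; rewrite brownian_increment_mean mul0r mule0 mul0e.
Qed.

End brownian_increments.

(** * Second-moment matrices *)

Section second_moments.
Context {d0 : measure_display} {T : measurableType d0} {R : realType}.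
Variables (P : probability T R) (G : set (set T)).
Hypotheses (sG : sigma_algebra [set: T] G) (subG : G `<=` measurable).

Let L2 (f : T -> R) : Prop :=
  measurable_wrt G f /\ P.-integrable [set: T] (fun w => (f w ^+ 2)%:E).

Let measurable_L2 f : L2 f -> measurable_fun setT f.
Proof. by move=> [mf _] _ A mA; rewrite setTI; apply/subG/mf. Qed.

Let L2_integrableM f g : L2 f -> L2 g ->
  P.-integrable [set: T] (EFin \o (fun w => f w * g w)).
Proof.
move=> /[dup] /measurable_L2 mf [_ f2] /[dup] /measurable_L2 mg [_ g2].
apply: (le_integrable _ _ _ (integrableD _ f2 g2)) => //.
  by apply/measurable_EFinP; exact: measurable_funM.
move=> w _ /=; rewrite lee_fin (ger0_norm (addr_ge0 (sqr_ge0 _) (sqr_ge0 _))).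
have := sqr_ge0 (f w - g w); have := sqr_ge0 (f w + g w).
have := sqr_ge0 (f w); have := sqr_ge0 (g w).
by rewrite ler_norml => *; apply/andP; split; nra.
Qed.

Let L2D f g : L2 f -> L2 g -> L2 (fun w => f w + g w).
Proof.
move=> Lf Lg; have [[mf f2] [mg g2]] := (Lf, Lg); split; first exact: measurable_wrtD.
have fg := L2_integrableM Lf Lg.
apply: eq_integrable (integrableD _ (integrableD _ f2 fg) (integrableD _ fg g2)) => //.
by move=> w _ /=; congr EFin; rewrite sqrrD; ring.
Qed.

Let L2Z c f : L2 f -> L2 (fun w => c * f w).
Proof.
move=> [mf f2]; split; first exact: measurable_wrtZ.
apply: eq_integrable (integrableZl _ (c ^+ 2) f2) => //.
by move=> w _ /=; rewrite -EFinM exprMn.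
Qed.

Let L2_0 : L2 (fun=> 0).
Proof.
split; first exact: measurable_wrt_cst.
by under eq_fun do rewrite expr0n /=; exact: integrable0.
Qed.

Let L2_vector_ext n (X : T -> 'cV[R]_n) (f : 'I_n -> T -> R) :
  (forall i w, X w i ord0 = f i w) -> (forall i, L2 (f i)) -> L2_vector P G X.
Proof.
move=> Xf Lf i; have := Lf i.
by rewrite (_ : f i = fun w => X w i ord0) //; apply/funext => w; rewrite Xf.
Qed.

Lemma L2_vectorD n (X Y : T -> 'cV[R]_n) : L2_vector P G X -> L2_vector P G Y ->
  L2_vector P G (fun w => X w + Y w).
Proof.
move=> LX LY; apply: L2_vector_ext (fun i => L2D (LX i) (LY i)) => i w.
by rewrite mxE.
Qed.

Lemma L2_vector0 n : L2_vector P G (fun=> 0 : 'cV[R]_n).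
Proof. by apply: L2_vector_ext (fun=> L2_0) => i w; rewrite mxE. Qed.

Lemma L2_vector_sum n (I : finType) (X : I -> T -> 'cV[R]_n) :
  (forall i, L2_vector P G (X i)) -> L2_vector P G (fun w => \sum_i X i w).
Proof.
move=> LX; elim: (index_enum I) => [|i r IHr].
  under eq_fun do rewrite big_nil; exact: L2_vector0.
by under eq_fun do rewrite big_cons; exact: L2_vectorD.
Qed.

Lemma L2_vector_mulmx n p (M : 'M[R]_(p, n)) (X : T -> 'cV[R]_n) :
  L2_vector P G X -> L2_vector P G (fun w => M *m X w).
Proof.
move=> LX; apply: (L2_vector_ext (f := fun i w => \sum_j M i j * X w j ord0)).
  by move=> i w; rewrite mxE.
move=> i; elim: (index_enum _) => [|j r IHr]; first by under eq_fun do rewrite big_nil.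
by under eq_fun do rewrite big_cons; exact: L2D (L2Z _ (LX j)) IHr.
Qed.

Lemma L2_vector_integrable n p (X : T -> 'cV[R]_n) (Y : T -> 'cV[R]_p) i j :
  L2_vector P G X -> L2_vector P G Y ->
  P.-integrable [set: T] (EFin \o (fun w => X w i ord0 * Y w j ord0)).
Proof. by move=> LX LY; apply: L2_integrableM; [exact: LX|exact: LY]. Qed.

Lemma mean_outerE n p (X : T -> 'cV[R]_n) (Y : T -> 'cV[R]_p) i j :
  mean_outer P X Y i j = \int[P]_w (X w i ord0 * Y w j ord0).
Proof. by rewrite mxE unlock. Qed.

Lemma mean_outer_trmx n p (X : T -> 'cV[R]_n) (Y : T -> 'cV[R]_p) :
  (mean_outer P X Y)^T = mean_outer P Y X.
Proof.
apply/matrixP => i j; rewrite mxE !mean_outerE.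
by apply: eq_Rintegral => w _; rewrite mulrC.
Qed.

Lemma mean_outerDl n p (X X' : T -> 'cV[R]_n) (Y : T -> 'cV[R]_p) :
  L2_vector P G X -> L2_vector P G X' -> L2_vector P G Y ->
  mean_outer P (fun w => X w + X' w) Y = mean_outer P X Y + mean_outer P X' Y.
Proof.
move=> LX LX' LY; apply/matrixP => i j; rewrite mean_outerE [RHS]mxE !mean_outerE.
rewrite -RintegralD//; [|exact: L2_vector_integrable|exact: L2_vector_integrable].
by apply: eq_Rintegral => w _; rewrite mxE mulrDl.
Qed.

Lemma mean_outer_suml n p (I : finType) (X : I -> T -> 'cV[R]_n) (Y : T -> 'cV[R]_p) :
  (forall i, L2_vector P G (X i)) -> L2_vector P G Y ->
  mean_outer P (fun w => \sum_i X i w) Y = \sum_i mean_outer P (X i) Y.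
Proof.
move=> LX LY.
(* Square integrability of the partial sums is carried through the induction, since additivity
   requires it at each stage. *)
suff [] : L2_vector P G (fun w => \sum_i X i w) /\
  mean_outer P (fun w => \sum_i X i w) Y = \sum_i mean_outer P (X i) Y by [].
elim: (index_enum I) => [|i r [IH1 IH2]].
  under eq_fun do rewrite big_nil; split; first exact: L2_vector0.
  rewrite big_nil; apply/matrixP => i j; rewrite mean_outerE !mxE.
  by under eq_Rintegral do rewrite mul0r; rewrite Rintegral_cst// mul0r.
under eq_fun do rewrite big_cons; split; first exact: L2_vectorD.
by rewrite big_cons mean_outerDl// IH2.
Qed.

Lemma mean_outer_mull n p q (M : 'M[R]_(q, n)) (X : T -> 'cV[R]_n) (Y : T -> 'cV[R]_p) :
  L2_vector P G X -> L2_vector P G Y ->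
  mean_outer P (fun w => M *m X w) Y = M *m mean_outer P X Y.
Proof.
move=> LX LY; apply/matrixP => i j; rewrite mean_outerE mxE.
under eq_bigr do rewrite mean_outerE.
have intX l := L2_vector_integrable l j LX LY.
under eq_Rintegral do rewrite mxE mulr_suml.
suff [] : P.-integrable setT (EFin \o (fun w => \sum_l M i l * X w l ord0 * Y w j ord0)) /\
  \int[P]_w (\sum_l M i l * X w l ord0 * Y w j ord0) =
  \sum_l M i l * \int[P]_w (X w l ord0 * Y w j ord0) by [].
elim: (index_enum _) => [|l r [IH1 IH2]].
  split; first by under eq_fun do rewrite big_nil; exact: integrable0.
  by under eq_Rintegral do rewrite big_nil; rewrite big_nil Rintegral_cst// mul0r.
have intl : P.-integrable setT (EFin \o (fun w => M i l * X w l ord0 * Y w j ord0)).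
  apply: eq_integrable (integrableZl _ (M i l) (intX l)) => //.
  by move=> w _ /=; rewrite -EFinM mulrA.
split.
  by under eq_fun do rewrite big_cons; apply: eq_integrable (integrableD _ intl IH1).
under eq_Rintegral do rewrite big_cons; rewrite big_cons RintegralD// -IH2; congr (_ + _).
by rewrite -RintegralZl//; apply: eq_Rintegral => w _; rewrite mulrA.
Qed.

Lemma mean_outerDr n p (X X' : T -> 'cV[R]_n) (Y : T -> 'cV[R]_p) :
  L2_vector P G X -> L2_vector P G X' -> L2_vector P G Y ->
  mean_outer P Y (fun w => X w + X' w) = mean_outer P Y X + mean_outer P Y X'.
Proof.
by move=> LX LX' LY; rewrite -mean_outer_trmx mean_outerDl// linearD/= !mean_outer_trmx.
Qed.

Lemma mean_outer_sumr n p (I : finType) (X : I -> T -> 'cV[R]_n) (Y : T -> 'cV[R]_p) :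
  (forall i, L2_vector P G (X i)) -> L2_vector P G Y ->
  mean_outer P Y (fun w => \sum_i X i w) = \sum_i mean_outer P Y (X i).
Proof.
move=> LX LY; rewrite -mean_outer_trmx mean_outer_suml// linear_sum/=.
by apply: eq_bigr => i _; rewrite mean_outer_trmx.
Qed.

Lemma mean_outer_mulr n p q (M : 'M[R]_(q, n)) (X : T -> 'cV[R]_n) (Y : T -> 'cV[R]_p) :
  L2_vector P G X -> L2_vector P G Y ->
  mean_outer P Y (fun w => M *m X w) = mean_outer P Y X *m M^T.
Proof.
by move=> LX LY; rewrite -mean_outer_trmx mean_outer_mull// trmx_mul mean_outer_trmx.
Qed.

Lemma integrable_dotv n (X : T -> 'cV[R]_n) : L2_vector P G X ->
  P.-integrable setT (EFin \o (fun w => dotv (X w) (X w))).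
Proof.
move=> LX; rewrite /dotv; elim: (index_enum _) => [|l r IH].
  by under eq_fun do rewrite big_nil; exact: integrable0.
under eq_fun do rewrite big_cons.
by apply: eq_integrable (integrableD _ (L2_vector_integrable l l LX LX) IH).
Qed.

Lemma tr_mean_outer n (X : T -> 'cV[R]_n) : L2_vector P G X ->
  \tr (mean_outer P X X) = \int[P]_w dotv (X w) (X w).
Proof.
move=> LX; rewrite /mxtrace /dotv; under eq_bigr do rewrite mean_outerE.
suff [] : P.-integrable setT (EFin \o (fun w => \sum_i X w i ord0 * X w i ord0)) /\
  \sum_i \int[P]_w (X w i ord0 * X w i ord0) =
  \int[P]_w (\sum_i X w i ord0 * X w i ord0) by [].
elim: (index_enum _) => [|l r [IH1 IH2]].
  split; first by under eq_fun do rewrite big_nil; exact: integrable0.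
  by under eq_Rintegral do rewrite big_nil; rewrite big_nil Rintegral_cst// mul0r.
have intl := L2_vector_integrable l l LX LX.
split.
  by under eq_fun do rewrite big_cons; apply: eq_integrable (integrableD _ intl IH1).
by under eq_Rintegral do rewrite big_cons; rewrite big_cons RintegralD// IH2.
Qed.

(** Square integrability makes the expectation finite, so the [fine] in [mean_outer] loses
    nothing. *)
Lemma mean_squareE n (X : T -> 'cV[R]_n) : L2_vector P G X ->
  mean_square P X = (\tr (mean_outer P X X))%:E.
Proof.
move=> LX; rewrite tr_mean_outer// /mean_square unlock /Rintegral.
under [LHS]eq_integral do rewrite euclid_norm_sqr.
by rewrite fineK//; exact: integrable_fin_num (integrable_dotv LX).
Qed.

Lemma tr_mean_outer_ge0 n (X : T -> 'cV[R]_n) : L2_vector P G X ->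
  0 <= \tr (mean_outer P X X).
Proof.
by move=> LX; rewrite tr_mean_outer//; apply: Rintegral_ge0 => w _; exact: dotvv_ge0.
Qed.

End second_moments.

(** * One step of the scheme *)

(* If [S] is the second-moment matrix of [Z], the last hypothesis is the normal
   equation: [Ut^T U Z] is the L^2 projection of [Z] onto the span of
   the coordinates of [U Z]. *)
Lemma tr_projection_le (R : realType) (k d : nat) (S : 'M[R]_d) (U Ut : 'M[R]_(k, d)) :
  S^T = S -> (forall G : 'M[R]_d, 0 <= \tr (G *m S *m G^T)) ->
  U *m S *m U^T *m Ut = U *m S ->
  \tr (Ut^T *m (U *m S *m U^T) *m Ut) <= \tr S.
Proof.
(* This is the mean square of the residual $\tilde U^T U Z - Z$. By the normal equation the square
   of the projection and both cross terms have the same trace, which leaves Pythagoras. *)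
move=> symS psd eqUt; have := psd (Ut^T *m U - 1%:M).
rewrite linearB /= trmx_mul trmxK trmx1.
rewrite !(mulmxBl, mulmxBr) !mulmx1 !mul1mx !linearB /=.
have -> : Ut^T *m U *m S *m (U^T *m Ut) = Ut^T *m (U *m S).
  by rewrite -eqUt !mulmxA.
have -> : \tr (S *m (U^T *m Ut)) = \tr (Ut^T *m U *m S).
  by rewrite -mxtrace_tr !trmx_mul trmxK symS.
by rewrite -(mulmxA Ut^T (U *m S *m U^T)) eqUt !mulmxA; lra.
Qed.

Section euler_maruyama_step.
Context {d0 : measure_display} {T : measurableType d0} {R : realType}.
Variables (P : probability T R) (F : R -> set (set T)) (m d : nat).
Variable W : 'I_m -> R -> T -> R.
Hypotheses (hF : usual_filtration P F) (hW : brownian_motion P F W).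
Variables (A : R -> 'M[R]_d) (B : 'I_m -> R -> 'M[R]_d) (tau : nat -> R).
Hypothesis htau : time_grid tau.

Lemma time_grid_ge0 n : 0 <= tau n.
Proof.
case: htau => tau0 tault; elim: n => [|n IHn]; first by rewrite tau0.
exact: le_trans IHn (ltW (tault n)).
Qed.

Lemma filtration_sub r : 0 <= r -> F r `<=` measurable.
Proof. by case: hF => _ + _ _ _ r0 => /(_ r r0)[]. Qed.

Lemma L2_vector_mono n p (X : T -> 'cV[R]_p) :
  L2_vector P (F (tau n)) X -> L2_vector P (F (tau n.+1)) X.
Proof.
case: htau => _ tault LX i; have [mX X2] := LX i; split => // C mC.
case: hF => _ _ Fm _ _.
exact: Fm (time_grid_ge0 n) (ltW (tault n)) _ (mX C mC).
Qed.

Variables (n : nat) (X : T -> 'cV[R]_d).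
Hypothesis LX : L2_vector P (F (tau n)) X.

Let s0 := time_grid_ge0 n.
Let t0 := time_grid_ge0 n.+1.
Let st : tau n < tau n.+1. Proof. by case: htau. Qed.
Let sFs := filtration_sigma_algebra hF s0.
Let sFt := filtration_sigma_algebra hF t0.
Let subFs := filtration_sub s0.
Let subFt := filtration_sub t0.

Let V i w : 'cV[R]_d := (W i (tau n.+1) w - W i (tau n) w) *: (B i (tau n) *m X w).
Let VE i w a : V i w a ord0 =
  (W i (tau n.+1) w - W i (tau n) w) * (B i (tau n) *m X w) a ord0.
Proof. by rewrite mxE. Qed.

Let M : 'M[R]_d := 1%:M + time_step tau n *: A (tau n).

Let LBX (C : 'M[R]_d) : L2_vector P (F (tau n)) (fun w => C *m X w).
Proof. exact: L2_vector_mulmx. Qed.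

Let mulBX (C C' : 'M[R]_d) a b :
  measurable_wrt (F (tau n)) (fun w => (C *m X w) a ord0 * (C' *m X w) b ord0) /\
  P.-integrable setT (EFin \o (fun w => (C *m X w) a ord0 * (C' *m X w) b ord0)).
Proof.
split; last exact: L2_vector_integrable (LBX C) (LBX C').
by apply: measurable_wrtM => //; [case: (LBX C a)|case: (LBX C' b)].
Qed.

(** A product of two square-integrable variables need not be square integrable; here it is, because
    the increment is independent of the past. *)
Let LV i : L2_vector P (F (tau n.+1)) (V i).
Proof.
move=> a; split.
  rewrite -/(measurable_wrt _ _); under eq_fun do rewrite VE.
  apply: measurable_wrtM => //; first exact: (brownian_increment_adapted hF hW s0 st).
  by case: (L2_vector_mono (LBX (B i (tau n))) a).
have [mf intf] := mulBX (B i (tau n)) (B i (tau n)) a a.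
have [H _] := expectation_mul_increments hF hW s0 st i i mf intf.
by apply: eq_integrable H => // w _ /=; rewrite VE; congr EFin; ring.
Qed.

Lemma EM_stepE w : X w + EM_increment W A B tau n X w = M *m X w + \sum_i V i w.
Proof. by rewrite /EM_increment addrA mulmxDl mul1mx -scalemxAl. Qed.

Lemma L2_EM_step : L2_vector P (F (tau n.+1))
  (fun w => X w + EM_increment W A B tau n X w).
Proof.
under eq_fun do rewrite EM_stepE.
apply: L2_vectorD => //; first exact: L2_vector_mono.
exact: (L2_vector_sum sFt subFt LV).
Qed.

Let mean_outer_V (C : 'M[R]_d) i : mean_outer P (fun w => C *m X w) (V i) = 0.
Proof.
apply/matrixP => a b; rewrite mean_outerE mxE.
have [mf intf] := mulBX C (B i (tau n)) a b.
have [_ H] := expectation_mul_increment hF hW s0 st i mf intf.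
rewrite /Rintegral -[RHS](congr1 fine H); congr fine.
by apply: eq_integral => w _; rewrite VE; congr EFin; ring.
Qed.

Let mean_outer_VV i j : mean_outer P (V i) (V j) =
  ((i == j)%:R * time_step tau n) *:
    (B i (tau n) *m mean_outer P X X *m (B j (tau n))^T).
Proof.
rewrite -(mean_outer_mull subFs) // -(mean_outer_mulr subFs) //.
apply/matrixP => a b; rewrite mean_outerE [RHS]mxE mean_outerE.
have [mf intf] := mulBX (B i (tau n)) (B j (tau n)) a b.
have [_ H] := expectation_mul_increments hF hW s0 st i j mf intf.
have := congr1 fine H; rewrite fineM//; last exact: integrable_fin_num.
rewrite /Rintegral => <-; congr fine.
by apply: eq_integral => w _; rewrite !VE; congr EFin; ring.
Qed.

(* The mixed terms vanish because the Brownian increments are centered,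
   independent of each other and of the past. *)
Lemma mean_outer_EM_step :
  let Z w := X w + EM_increment W A B tau n X w in
  let S := mean_outer P X X in
  mean_outer P Z Z = M *m S *m M^T +
    \sum_i time_step tau n *: (B i (tau n) *m S *m (B i (tau n))^T).
Proof.
rewrite /=; have -> : (fun w => X w + EM_increment W A B tau n X w) =
    (fun w => M *m X w + \sum_i V i w) by apply/funext => w; exact: EM_stepE.
have LMX : L2_vector P (F (tau n.+1)) (fun w => M *m X w) by exact: L2_vector_mono.
have LsV : L2_vector P (F (tau n.+1)) (fun w => \sum_i V i w).
  exact: (L2_vector_sum sFt subFt LV).
have LZ := L2_vectorD sFt subFt LMX LsV.
rewrite (mean_outerDl subFt LMX LsV LZ) !(mean_outerDr subFt LMX LsV)//.
have MV0 : mean_outer P (fun w => M *m X w) (fun w => \sum_i V i w) = 0.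
  by rewrite (mean_outer_sumr sFt subFt)// big1.
rewrite MV0 addr0 -(mean_outer_trmx P (fun w => M *m X w) (fun w => \sum_i V i w)).
rewrite MV0 trmx0 add0r.
rewrite (mean_outer_mull subFs)// (mean_outer_mulr subFs)// mulmxA.
congr (_ + _); rewrite (mean_outer_suml sFt subFt)//; apply: eq_bigr => i _.
rewrite (mean_outer_sumr sFt subFt)// (bigD1 i)//= big1 ?addr0.
  by rewrite mean_outer_VV eqxx mul1r.
by move=> j ji; rewrite mean_outer_VV eq_sym (negPf ji) mul0r scale0r.
Qed.

Lemma EM_step_contraction : (0 < d)%N ->
  let Z w := X w + EM_increment W A B tau n X w in
  \tr (mean_outer P Z Z) <= EM_factor A B tau n * \tr (mean_outer P X X).
Proof.
move=> d0' /=; set h := time_step tau n.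
have h0 : 0 <= h by rewrite subr_ge0 ltW.
rewrite mean_outer_EM_step linearD linear_sum /=.
have trE (C : 'M[R]_d) : \tr (C *m mean_outer P X X *m C^T) =
    \int[P]_w dotv (C *m X w) (C *m X w).
  rewrite -(tr_mean_outer subFs) ?(mean_outer_mull subFs)//.
  by rewrite (mean_outer_mulr subFs)// mulmxA.
have le_tr (C : 'M[R]_d) c : (forall x, dotv (C *m x) (C *m x) <= c * dotv x x) ->
    \tr (C *m mean_outer P X X *m C^T) <= c * \tr (mean_outer P X X).
  move=> HC; rewrite trE (tr_mean_outer subFs)// -RintegralZl//; last first.
    exact: (integrable_dotv subFs LX).
  apply: le_Rintegral => //.
  - exact: (integrable_dotv subFs (LBX C)).
  - exact: integrableZl (integrable_dotv subFs LX).
(* The estimate is proved for the factor without absolute value, which is enough because the trace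
   it multiplies is nonnegative. *)
apply: (@le_trans _ _ ((1 + lambda_max (A (tau n) + (A (tau n))^T) * h +
    sigma_max (A (tau n)) ^+ 2 * h ^+ 2 +
    \sum_i spectral_norm (B i (tau n)) ^+ 2 * h) * \tr (mean_outer P X X))).
  rewrite mulrDl; apply: lerD.
    (* Expansion: $|x + hAx|^2 = |x|^2 + h \langle x, (A + A^T)x\rangle + h^2 |Ax|^2$. *)
    apply: le_tr => x; rewrite mulmxDl mul1mx -scalemxAl -/h.
    rewrite !(dotvDl, dotvDr, dotvZl, dotvZr).
    have := lambda_max_ge d0' (_ : (A (tau n) + (A (tau n))^T)^T = _) x.
    rewrite linearD /= trmxK addrC => /(_ erefl).
    rewrite mulmxDl dotvDr (dotv_mulmxr (A (tau n))^T) trmxK => H1.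
    have := ler_wpM2l h0 H1; have := ler_wpM2l (sqr_ge0 h) (sigma_max_ge (A (tau n)) d0' x).
    by move=> *; lra.
  rewrite mulr_suml; apply: ler_sum => i _; rewrite linearZ /= mulrC mulrAC.
  by rewrite ler_wpM2r//; apply: le_tr => x; exact: spectral_norm_ge.
by rewrite ler_wpM2r ?ler_norm// (tr_mean_outer_ge0 subFs).
Qed.

End euler_maruyama_step.

(** * Projected step and iteration along the grid *)

Section dlr_scheme.
Context {d0 : measure_display} {T : measurableType d0} {R : realType}.
Variables (P : probability T R) (F : R -> set (set T)) (m d k : nat).
Variable W : 'I_m -> R -> T -> R.
Hypotheses (hF : usual_filtration P F) (hW : brownian_motion P F W).
Variables (A : R -> 'M[R]_d) (B : 'I_m -> R -> 'M[R]_d) (tau : nat -> R).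
Hypotheses (htau : time_grid tau) (d_gt0 : (0 < d)%N).

Lemma DLR_step_contraction n (U U' : 'M[R]_(k, d)) (Y Y' : T -> 'cV[R]_k) :
  orthonormal_rows U -> L2_vector P (F (tau n)) Y ->
  DLR_step P W A B tau n U Y U' Y' ->
  [/\ orthonormal_rows U', L2_vector P (F (tau n.+1)) Y' &
    \tr (mean_outer P (fun w => U'^T *m Y' w) (fun w => U'^T *m Y' w)) <=
    EM_factor A B tau n *
      \tr (mean_outer P (fun w => U^T *m Y w) (fun w => U^T *m Y w))].
Proof.
move=> oU LY [Ut [Q [[eqUt _] [QR oU' _] Y'E]]].
have s0 := time_grid_ge0 htau n; have t0 := time_grid_ge0 htau n.+1.
have sFs := filtration_sigma_algebra hF s0.
have sFt := filtration_sigma_algebra hF t0.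
have subFs := filtration_sub hF s0.
have subFt := filtration_sub hF t0.
pose X w := U^T *m Y w.
have LX : L2_vector P (F (tau n)) X by exact: L2_vector_mulmx.
pose D := EM_increment W A B tau n X.
pose Z w := X w + D w.
have LZ : L2_vector P (F (tau n.+1)) Z by exact: L2_EM_step.
have YtE w : Y w + U *m D w = U *m Z w.
  by rewrite /Z mulmxDr /X mulmxA oU mul1mx.
have LYt : L2_vector P (F (tau n.+1)) (fun w => U *m Z w).
  exact: L2_vector_mulmx.
move: eqUt Y'E.
have -> : (fun w => Y w + U *m EM_increment W A B tau n (fun w => U^T *m Y w) w) =
    (fun w => U *m Z w) by apply/funext => w; exact: YtE.
rewrite -/X -/D => eqUt Y'E.
have {}Y'E : Y' = (fun w => Q *m (U *m Z w)) by apply/funext => w; rewrite Y'E YtE.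
set S := mean_outer P Z Z.
have CE : mean_outer P (fun w => U *m Z w) (fun w => U *m Z w) = U *m S *m U^T.
  by rewrite (mean_outer_mull subFt)// (mean_outer_mulr subFt)// mulmxA.
have LXt : L2_vector P (F (tau n.+1)) X by exact: (L2_vector_mono hF htau LX).
have LD : L2_vector P (F (tau n.+1)) D.
  have -> : D = (fun w => Z w + (-1)%:M *m X w).
    by apply/funext => w; rewrite mul_scalar_mx scaleN1r /Z addrAC subrr add0r.
  by apply: L2_vectorD => //; exact: L2_vector_mulmx.
(* [I - P_U] annihilates [X], so [D] can be replaced by [Z = X + D]. *)
have DP : mean_outer P (fun w => U *m Z w) D *m (1%:M - rowproj U) =
    U *m S *m (1%:M - rowproj U).
  have UP : U *m (1%:M - rowproj U) = 0.
    by rewrite mulmxBr mulmx1 /rowproj mulmxA oU mul1mx subrr.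
  have ZE : S = mean_outer P Z X + mean_outer P Z D := mean_outerDr subFt LXt LD LZ.
  rewrite (mean_outer_mull subFt)// ZE.
  rewrite (mulmxDr U) mulmxDl [X in _ = X + _](_ : _ = 0) ?add0r//.
  rewrite /X (mean_outer_mulr subFt)//; last exact: (L2_vector_mono hF htau LY).
  by rewrite trmxK -!mulmxA UP !mulmx0.
have normal_eq : U *m S *m U^T *m Ut = U *m S.
  rewrite -CE eqUt CE DP mulmxBr mulmx1 /rowproj !mulmxA.
  by rewrite addrC subrK.
split=> //.
  by rewrite Y'E; exact: L2_vector_mulmx.
(* The QR factors recombine through $U'^T Q = \tilde U^T$: orthonormalization changes the
   representation, not the process. *)
have -> : (fun w => U'^T *m Y' w) = (fun w => Ut^T *m (U *m Z w)).
  by apply/funext => w; rewrite Y'E mulmxA -QR.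
have LUt : L2_vector P (F (tau n.+1)) (fun w => Ut^T *m (U *m Z w)).
  exact: L2_vector_mulmx.
rewrite (mean_outer_mull subFt Ut^T LYt LUt) (mean_outer_mulr subFt Ut^T LYt LYt).
rewrite CE trmxK mulmxA.
apply: le_trans (EM_step_contraction hF hW A B htau LX d_gt0).
apply: tr_projection_le => //; first by rewrite mean_outer_trmx.
(* The trace of $G S G^T$ is the mean square of $GZ$. *)
move=> G.
rewrite -(mean_outer_mull subFt)// -(mean_outer_mulr subFt)//; last exact: L2_vector_mulmx.
by apply: (tr_mean_outer_ge0 subFt); exact: L2_vector_mulmx.
Qed.

Lemma DLR_scheme_mean_square (U : nat -> 'M[R]_(k, d)) (Y : nat -> T -> 'cV[R]_k) n :
  DLR_scheme P F W A B tau U Y ->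
  (mean_square P (fun w => (U n)^T *m Y n w) <=
   (\prod_(j < n) EM_factor A B tau j)%:E *
     mean_square P (fun w => ((U 0%N)^T *m Y 0%N w)))%E /\
  mean_square P (fun w => ((U 0%N)^T *m Y 0%N w)) \is a fin_num.
Proof.
case=> oU0 LY0 step.
have tau0 : tau 0%N = 0 by case: htau.
pose q j := \tr (mean_outer P (fun w => (U j)^T *m Y j w) (fun w => (U j)^T *m Y j w)).
have inv j : [/\ orthonormal_rows (U j), L2_vector P (F (tau j)) (Y j) &
    q j <= (\prod_(i < j) EM_factor A B tau i) * q 0%N].
  elim: j => [|j [oU LY IH]]; first by rewrite tau0 big_ord0 mul1r.
  have [oU' LY' H] := DLR_step_contraction oU LY (step j).
  split=> //; apply: le_trans H _; rewrite big_ord_recr /= mulrAC mulrC.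
  by rewrite ler_wpM2r// normr_ge0.
have msE j : mean_square P (fun w => (U j)^T *m Y j w) = (q j)%:E.
  have t0 := time_grid_ge0 htau j; have [_ LY _] := inv j.
  have sFt := filtration_sigma_algebra hF t0; have subFt := filtration_sub hF t0.
  by rewrite (mean_squareE subFt)//; exact: L2_vector_mulmx.
by rewrite !msE; split => //; have [_ _] := inv n; rewrite -EFinM lee_fin.
Qed.

End dlr_scheme.

(** Factors below 1 keep their products at most 1, which is stability. Decay is stated under the
    condition that the products tend to 0, because factors may approach 1 too fast. *)
Theorem proposition6p5 (R : realType) (d0 : measure_display)
    (T : measurableType d0) (P : probability T R)
    (F : R -> set (set T)) (hF : usual_filtration P F)
    (m d k : nat) (hk : (1 <= k <= d)%N)
    (W : 'I_m -> R -> T -> R) (hW : brownian_motion P F W)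
    (A : R -> 'M[R]_d) (B : 'I_m -> R -> 'M[R]_d)
    (hA : uniformly_lipschitz A) (hB : forall i, uniformly_lipschitz (B i))
    (tau : nat -> R) (htau : time_grid tau)
    (hfactor : forall n, EM_factor A B tau n < 1) :
  ms_stable P (DLR_solutions P F W A B tau k) /\
  (\prod_(j < n) EM_factor A B tau j @[n --> \oo] --> (0 : R) ->
   asymptotically_ms_stable P (DLR_solutions P F W A B tau k)).
Proof.
have d_gt0 : (0 < d)%N by case/andP: hk => k1; exact: leq_trans.
have ms_ge0 n (X : T -> 'cV[R]_n) : (0 <= mean_square P X)%E.
  by rewrite /mean_square unlock; apply: integral_ge0 => w _; rewrite lee_fin sqr_ge0.
have prod_le1 n : \prod_(j < n) EM_factor A B tau j <= 1.
  elim: n => [|n IHn]; first by rewrite big_ord0.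
  rewrite big_ord_recr /=; apply: mulr_ile1; last exact: ltW.
  - by apply: prodr_ge0 => j _; exact: normr_ge0.
  - exact: normr_ge0.
  - exact: IHn.
have stable : ms_stable P (DLR_solutions P F W A B tau k).
  (* Termwise bounds only give a supremum at most [delta]; halving restores the strict
     inequality. *)
  move=> e e0; exists (e / 2) => [|X [U [Y [scheme ->]]] Xd]; first by rewrite divr_gt0.
  apply: (@le_lt_trans _ _ (e / 2)%:E); last by rewrite lte_fin ltr_pdivrMr// mulr2n; lra.
  apply: ge_ereal_sup => _ [n _ <-].
  have [H fin0] := DLR_scheme_mean_square hF hW htau d_gt0 n scheme.
  apply: le_trans H (le_trans _ (ltW Xd)).
  rewrite -[leRHS]mul1e; apply: lee_wpmul2r; first exact: ms_ge0.
  by rewrite lee_fin.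
split=> // prod0; split=> // X [U [Y [scheme ->]]].
have [_ fin0] := DLR_scheme_mean_square hF hW htau d_gt0 0%N scheme.
apply: (@squeeze_cvge _ _ _ _ (cst 0%E) _
  (fun n => (\prod_(j < n) EM_factor A B tau j)%:E *
    mean_square P (fun w => ((U 0%N)^T *m Y 0%N w)))%E).
- apply: nearW => n; rewrite ms_ge0 /=.
  by have [] := DLR_scheme_mean_square hF hW htau d_gt0 n scheme.
- exact: cvg_cst.
- rewrite -[X in _ --> X](mul0e (mean_square P (fun w => ((U 0%N)^T *m Y 0%N w)))).
  (* Finiteness of the initial mean square, [fin0], excludes the product of 0 and infinity in the
     limit. *)
  apply: cvgeZr => //.
  by apply: cvg_EFin => //; exact: nearW.
Qed.
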